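(* Let $L\dashv G$ be an opmonoidal adjunction with $L\colon\mathcal{D}\to\mathcal{C}$ and $G\colon\mathcal{C}\to\mathcal{D}$ such that the projection formula holds for $L$. Then $L$ induces an oplax monoidal functor $$\mathcal{Z}(L)\colon\mathcal{Z}(\mathcal{D})\to\mathcal{Z}(\mathcal{C}),\qquad(D,c)\mapsto(LD,c^L),$$ $$c^L_A=\Big(LD\otimes A\xrightarrow{(\mathrm{rproj}^L_{D,A})^{-1}}L(D\otimes GA)\xrightarrow{L(c_{GA})}L(GA\otimes D)\xrightarrow{\mathrm{lproj}^L_{A,D}}A\otimes LD\Big)\qquad(A\in\mathcal{C}).$$ Its oplax monoidal structure is given by $\mathrm{oplax}^{\mathcal{Z}(L)}_{(D,c),(E,d)}=\mathrm{oplax}^L_{D,E}$ and $\mathrm{oplax}^{\mathcal{Z}(L)}_0=\mathrm{oplax}^L_0$ for any objects $(D,c),(E,d)$ in $\mathcal{Z}(\mathcal{D})$. Moreover, $\mathcal{Z}(L)$ is braided.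
   Context: Conventions: monoidal categories are written as if strict. An oplax monoidal functor $F$ has coherent natural maps $\mathrm{oplax}^F_{X,Y}\colon F(X\otimes Y)\to FX\otimes FY$ and $\mathrm{oplax}^F_0\colon F\mathbb{1}\to\mathbb{1}$. An opmonoidal adjunction $L\dashv G$ is an adjunction in which $L,G$ are oplax monoidal and the unit and counit are monoidal (compatible with the oplax structures); then the right adjoint $G$ is strong monoidal. Projection formula morphisms, for $A\in\mathcal{C}$, $X\in\mathcal{D}$: $\mathrm{lproj}^L_{A,X}=(\mathrm{counit}_A\otimes LX)\circ\mathrm{oplax}^L_{GA,X}\colon L(GA\otimes X)\to A\otimes LX$ and $\mathrm{rproj}^L_{X,A}=(LX\otimes\mathrm{counit}_A)\circ\mathrm{oplax}^L_{X,GA}\colon L(X\otimes GA)\to LX\otimes A$. The projection formula holds for $L$ if all of these are isomorphisms. The Drinfeld center $\mathcal{Z}(\mathcal{C})$ has objects $(X,c)$ with $c=(c_A\colon X\otimes A\xrightarrow{\sim}A\otimes X)_{A}$ natural, $c_{A\otimes B}=(A\otimes c_B)(c_A\otimes B)$, $c_{\mathbb{1}}=\mathrm{id}$; morphisms commute with half-braidings; $(X,c)\otimes(Y,d)=(X\otimes Y,(c_A\otimes Y)(X\otimes d_A))$; braiding $\Psi_{(X,c),(Y,d)}=c_Y$. $\mathcal{Z}(L)$ acts as $L$ on morphisms. An oplax monoidal functor $F$ between braided categories is braided if $\Psi_{FX,FY}\circ\mathrm{oplax}_{X,Y}=\mathrm{oplax}_{Y,X}\circ F(\Psi_{X,Y})$.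 *)

(* Defs.v *)
From Stdlib Require Import ssreflect ProofIrrelevance.

Set Implicit Arguments.
Unset Strict Implicit.
Unset Printing Implicit Defensive.

(* Monoidal categories are not assumed strict: associators and unitors are
   written out wherever strict notation suppresses them. *)

Declare Scope cat_scope.
Delimit Scope cat_scope with cat.
Local Open Scope cat_scope.

Reserved Notation "g ∘ f" (at level 41, right associativity).
Reserved Notation "X ⊗ Y" (at level 35, right associativity).
Reserved Notation "f ⊠ g" (at level 35, right associativity).

Record Category := {
  ob :> Type;
  Hom : ob -> ob -> Type;
  id : forall X, Hom X X;
  comp : forall X Y Z, Hom Y Z -> Hom X Y -> Hom X Z;
  comp_id_l : forall X Y (f : Hom X Y), comp (id Y) f = f;
  comp_id_r : forall X Y (f : Hom X Y), comp f (id X) = f;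
  comp_assoc : forall W X Y Z (h : Hom Y Z) (g : Hom X Y) (f : Hom W X),
    comp (comp h g) f = comp h (comp g f)
}.
Arguments Hom {_} _ _.
Arguments id {_} _.
Arguments comp {_ _ _ _} _ _.
Notation "g ∘ f" := (comp g f) : cat_scope.

(* The inverse is data; it is unique, so this carries no choice. *)
Record IsIso {C : Category} {X Y : C} (f : Hom X Y) := {
  inv : Hom Y X;
  inv_l : inv ∘ f = id X;
  inv_r : f ∘ inv = id Y
}.
Arguments inv {_ _ _ _} _.

Record MonCat := {
  mon_cat :> Category;
  tens : mon_cat -> mon_cat -> mon_cat;
  tens_hom : forall X X' Y Y' : mon_cat,
    Hom X X' -> Hom Y Y' -> Hom (tens X Y) (tens X' Y');
  munit : mon_cat;
  assoc : forall X Y Z, Hom (tens (tens X Y) Z) (tens X (tens Y Z));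
  lunit : forall X, Hom (tens munit X) X;
  runit : forall X, Hom (tens X munit) X;
  assoc_iso : forall X Y Z, IsIso (assoc X Y Z);
  lunit_iso : forall X, IsIso (lunit X);
  runit_iso : forall X, IsIso (runit X);
  tens_id : forall X Y, tens_hom (id X) (id Y) = id (tens X Y);
  tens_comp : forall X X' X'' Y Y' Y''
      (f' : Hom X' X'') (f : Hom X X') (g' : Hom Y' Y'') (g : Hom Y Y'),
    tens_hom (f' ∘ f) (g' ∘ g) = tens_hom f' g' ∘ tens_hom f g;
  assoc_nat : forall X X' Y Y' Z Z'
      (f : Hom X X') (g : Hom Y Y') (h : Hom Z Z'),
    assoc X' Y' Z' ∘ tens_hom (tens_hom f g) h
    = tens_hom f (tens_hom g h) ∘ assoc X Y Z;
  lunit_nat : forall X Y (f : Hom X Y),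
    lunit Y ∘ tens_hom (id munit) f = f ∘ lunit X;
  runit_nat : forall X Y (f : Hom X Y),
    runit Y ∘ tens_hom f (id munit) = f ∘ runit X;
  pentagon : forall W X Y Z,
    assoc W X (tens Y Z) ∘ assoc (tens W X) Y Z
    = tens_hom (id W) (assoc X Y Z) ∘ assoc W (tens X Y) Z
      ∘ tens_hom (assoc W X Y) (id Z);
  triangle : forall X Y,
    tens_hom (id X) (lunit Y) ∘ assoc X munit Y = tens_hom (runit X) (id Y)
}.
Arguments tens {_} _ _.
Arguments tens_hom {_ _ _ _ _} _ _.
Arguments munit {_}.
Arguments assoc {_} _ _ _.
Arguments lunit {_} _.
Arguments runit {_} _.
Notation "X ⊗ Y" := (tens X Y) : cat_scope.
Notation "f ⊠ g" := (tens_hom f g) : cat_scope.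
Notation "𝟙" := munit : cat_scope.

Definition associnv {C : MonCat} (X Y Z : C) : Hom (X ⊗ (Y ⊗ Z)) ((X ⊗ Y) ⊗ Z)
  := inv (assoc_iso X Y Z).
Definition lunitinv {C : MonCat} (X : C) : Hom X (𝟙 ⊗ X) := inv (lunit_iso X).
Definition runitinv {C : MonCat} (X : C) : Hom X (X ⊗ 𝟙) := inv (runit_iso X).

Record BraidedCat := {
  braided_mon :> MonCat;
  braiding : forall X Y : braided_mon, Hom (X ⊗ Y) (Y ⊗ X);
  braiding_iso : forall X Y, IsIso (braiding X Y);
  braiding_nat : forall X X' Y Y' (f : Hom X X') (g : Hom Y Y'),
    braiding X' Y' ∘ (f ⊠ g) = (g ⊠ f) ∘ braiding X Y;
  hexagon1 : forall X Y Z,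
    assoc Y Z X ∘ braiding X (Y ⊗ Z) ∘ assoc X Y Z
    = (id Y ⊠ braiding X Z) ∘ assoc Y X Z ∘ (braiding X Y ⊠ id Z);
  hexagon2 : forall X Y Z,
    associnv Z X Y ∘ braiding (X ⊗ Y) Z ∘ associnv X Y Z
    = (braiding X Z ⊠ id Y) ∘ associnv X Z Y ∘ (id X ⊠ braiding Y Z)
}.
Arguments braiding {_} _ _.

(* Laws are separated from data so that functors with a prescribed action on
   objects, morphisms and coherence maps can be asserted to exist. *)
Record FunctorLaws {C D : Category} (Fo : C -> D)
    (Fm : forall X Y : C, Hom X Y -> Hom (Fo X) (Fo Y)) : Prop := {
  law_id : forall X, Fm X X (id X) = id (Fo X);
  law_comp : forall X Y Z (g : Hom Y Z) (f : Hom X Y),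
    Fm X Z (g ∘ f) = Fm Y Z g ∘ Fm X Y f
}.

Record Functor (C D : Category) := {
  fob :> C -> D;
  fmap : forall X Y : C, Hom X Y -> Hom (fob X) (fob Y);
  functor_laws : FunctorLaws fmap
}.
Arguments fmap {_ _} _ {_ _} _.

Record OplaxLaws {C D : MonCat} (F : Functor C D)
    (o : forall X Y : C, Hom (F (X ⊗ Y)) (F X ⊗ F Y))
    (o0 : Hom (F 𝟙) 𝟙) : Prop := {
  law_nat : forall X X' Y Y' (f : Hom X X') (g : Hom Y Y'),
    o X' Y' ∘ fmap F (f ⊠ g) = (fmap F f ⊠ fmap F g) ∘ o X Y;
  law_assoc : forall X Y Z,
    assoc (F X) (F Y) (F Z) ∘ (o X Y ⊠ id (F Z)) ∘ o (X ⊗ Y) Z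
    = (id (F X) ⊠ o Y Z) ∘ o X (Y ⊗ Z) ∘ fmap F (assoc X Y Z);
  law_lunit : forall X,
    lunit (F X) ∘ (o0 ⊠ id (F X)) ∘ o 𝟙 X = fmap F (lunit X);
  law_runit : forall X,
    runit (F X) ∘ (id (F X) ⊠ o0) ∘ o X 𝟙 = fmap F (runit X)
}.

Record OplaxFunctor (C D : MonCat) := {
  oplax_functor :> Functor C D;
  oplax : forall X Y : C,
    Hom (oplax_functor (X ⊗ Y)) (oplax_functor X ⊗ oplax_functor Y);
  oplax0 : Hom (oplax_functor 𝟙) 𝟙;
  oplax_laws : OplaxLaws oplax oplax0
}.
Arguments oplax {_ _} _ _ _.
Arguments oplax0 {_ _} _.

Definition IsBraided {C D : BraidedCat} (F : OplaxFunctor C D) : Prop :=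
  forall X Y : C,
    braiding (F X) (F Y) ∘ oplax F X Y = oplax F Y X ∘ fmap F (braiding X Y).

Definition id_functor (C : Category) : Functor C C :=
  Build_Functor (fob := fun X => X) (fmap := fun X Y f => f)
    (Build_FunctorLaws (fun X => eq_refl) (fun X Y Z g f => eq_refl)).

Lemma comp_functor_laws (C D E : Category) (G : Functor D E) (F : Functor C D) :
  @FunctorLaws C E (fun X => G (F X)) (fun X Y f => fmap G (fmap F f)).
Proof.
case: G F => [Go Gm [G1 G2]] [Fo Fm [F1 F2]]; split=> * /=.
- by rewrite F1 G1.
- by rewrite F2 G2.
Qed.

Definition comp_functor {C D E : Category} (G : Functor D E) (F : Functor C D) :
  Functor C E := Build_Functor (comp_functor_laws G F).

Lemma id_oplax_laws (C : MonCat) :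
  OplaxLaws (F := id_functor C) (fun X Y => id (X ⊗ Y)) (id 𝟙).
Proof. by split=> * /=; rewrite ?tens_id ?comp_id_l ?comp_id_r. Qed.

Definition id_oplax (C : MonCat) : OplaxFunctor C C :=
  Build_OplaxFunctor (id_oplax_laws C).

Lemma re2 {C : Category} {X Y Z W : C} {f : Hom Y Z} {g : Hom X Y} {h : Hom X Z} :
  f ∘ g = h -> forall k : Hom W X, f ∘ g ∘ k = h ∘ k.
Proof. by move=> <- k; rewrite comp_assoc. Qed.

Lemma re3 {C : Category} {X Y Z W V : C} {f : Hom Y Z} {g : Hom X Y}
    {h : Hom W X} {k : Hom W Z} :
  f ∘ g ∘ h = k -> forall m : Hom V W, f ∘ g ∘ h ∘ m = k ∘ m.
Proof. by move=> <- m; rewrite !comp_assoc. Qed.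

Lemma tens_split_l {C : MonCat} {X X' X'' Y : C} (f : Hom X' X'') (g : Hom X X') :
  (f ∘ g) ⊠ id Y = (f ⊠ id Y) ∘ (g ⊠ id Y).
Proof. by rewrite -tens_comp comp_id_l. Qed.

Lemma tens_split_r {C : MonCat} {X X' X'' Y : C} (f : Hom X' X'') (g : Hom X X') :
  id Y ⊠ (f ∘ g) = (id Y ⊠ f) ∘ (id Y ⊠ g).
Proof. by rewrite -tens_comp comp_id_l. Qed.

Lemma comp_oplax_laws (C D E : MonCat) (G : OplaxFunctor D E) (F : OplaxFunctor C D) :
  OplaxLaws (F := comp_functor G F)
    (fun X Y => oplax G (F X) (F Y) ∘ fmap G (oplax F X Y))
    (oplax0 G ∘ fmap G (oplax0 F)).
Proof.
case: G F => [[Go Gm [G1 G2]] oG oG0 [/= nG aG lG rG]]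
  [[Fo Fm [F1 F2]] oF oF0 [/= nF aF lF rF]]; split=> /=.
- move=> X X' Y Y' f g.
  by rewrite comp_assoc -G2 nF G2 -!comp_assoc nG.
- move=> X Y Z; rewrite tens_split_l tens_split_r !comp_assoc.
  have -> : Gm _ _ (oF X Y) ⊠ id (Go (Fo Z)) = Gm _ _ (oF X Y) ⊠ Gm _ _ (id (Fo Z))
    by rewrite G1.
  have -> : id (Go (Fo X)) ⊠ Gm _ _ (oF Y Z) = Gm _ _ (id (Fo X)) ⊠ Gm _ _ (oF Y Z)
    by rewrite G1.
  rewrite (re2 (eq_sym (nG _ _ _ _ _ _))) (re2 (eq_sym (nG _ _ _ _ _ _))).
  rewrite !comp_assoc -!G2 -aF (re3 (aG _ _ _)) !comp_assoc.
  by rewrite -G2.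
- move=> X; rewrite tens_split_l !comp_assoc.
  have -> : Gm _ _ oF0 ⊠ id (Go (Fo X)) = Gm _ _ oF0 ⊠ Gm _ _ (id (Fo X))
    by rewrite G1.
  by rewrite (re2 (eq_sym (nG _ _ _ _ _ _))) !comp_assoc (re3 (lG _)) -!G2 lF.
- move=> X; rewrite tens_split_r !comp_assoc.
  have -> : id (Go (Fo X)) ⊠ Gm _ _ oF0 = Gm _ _ (id (Fo X)) ⊠ Gm _ _ oF0
    by rewrite G1.
  by rewrite (re2 (eq_sym (nG _ _ _ _ _ _))) !comp_assoc (re3 (rG _)) -!G2 rF.
Qed.

Definition comp_oplax {C D E : MonCat}
    (G : OplaxFunctor D E) (F : OplaxFunctor C D) : OplaxFunctor C E :=
  Build_OplaxFunctor (comp_oplax_laws G F).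

Definition IsNatural {C D : Category} (F G : Functor C D)
    (t : forall X, Hom (F X) (G X)) : Prop :=
  forall X Y (f : Hom X Y), t Y ∘ fmap F f = fmap G f ∘ t X.

Record IsMonoidal {C D : MonCat} (F G : OplaxFunctor C D)
    (t : forall X, Hom (F X) (G X)) : Prop := {
  monoidal_tens : forall X Y,
    oplax G X Y ∘ t (X ⊗ Y) = (t X ⊠ t Y) ∘ oplax F X Y;
  monoidal_unit : oplax0 G ∘ t 𝟙 = oplax0 F
}.

Record Adjunction {D C : Category} (L : Functor D C) (G : Functor C D) := {
  adj_unit : forall X : D, Hom X (G (L X));
  adj_counit : forall A : C, Hom (L (G A)) A;
  adj_unit_nat : IsNatural (F := id_functor D) (G := comp_functor G L) adj_unit;
  adj_counit_nat : IsNatural (F := comp_functor L G) (G := id_functor C) adj_counit;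
  adj_triangle_l : forall X, adj_counit (L X) ∘ fmap L (adj_unit X) = id (L X);
  adj_triangle_r : forall A, fmap G (adj_counit A) ∘ adj_unit (G A) = id (G A)
}.

(* Strong monoidality of G is a consequence of these axioms, so it is not assumed. *)
Record OpmonoidalAdjunction {D C : MonCat}
    (L : OplaxFunctor D C) (G : OplaxFunctor C D) := {
  opmon_adj :> Adjunction L G;
  unit_monoidal :
    IsMonoidal (F := id_oplax D) (G := comp_oplax G L) (adj_unit opmon_adj);
  counit_monoidal :
    IsMonoidal (F := comp_oplax L G) (G := id_oplax C) (adj_counit opmon_adj)
}.

Definition lproj {D C : MonCat} {L : OplaxFunctor D C} {G : OplaxFunctor C D}
    (adj : OpmonoidalAdjunction L G) (A : C) (X : D) :
    Hom (L (G A ⊗ X)) (A ⊗ L X) :=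
  (adj_counit adj A ⊠ id (L X)) ∘ oplax L (G A) X.

Definition rproj {D C : MonCat} {L : OplaxFunctor D C} {G : OplaxFunctor C D}
    (adj : OpmonoidalAdjunction L G) (X : D) (A : C) :
    Hom (L (X ⊗ G A)) (L X ⊗ A) :=
  (id (L X) ⊠ adj_counit adj A) ∘ oplax L X (G A).

Record ProjectionFormula {D C : MonCat}
    {L : OplaxFunctor D C} {G : OplaxFunctor C D}
    (adj : OpmonoidalAdjunction L G) := {
  lproj_iso : forall A X, IsIso (lproj adj A X);
  rproj_iso : forall X A, IsIso (rproj adj X A)
}.

(* hb_tens is c_{A⊗B} = (A ⊗ c_B)(c_A ⊗ B) with the associators inserted, and
   hb_unit is c_𝟙 = id with 𝟙 ⊗ X and X ⊗ 𝟙 identified with X by the unitors. *)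
Record IsHalfBraiding {C : MonCat} {X : C}
    (c : forall A : C, Hom (X ⊗ A) (A ⊗ X)) := {
  hb_iso : forall A, IsIso (c A);
  hb_nat : forall A B (f : Hom A B), c B ∘ (id X ⊠ f) = (f ⊠ id X) ∘ c A;
  hb_tens : forall A B,
    assoc A B X ∘ c (A ⊗ B) ∘ assoc X A B
    = (id A ⊠ c B) ∘ assoc A X B ∘ (c A ⊠ id B);
  hb_unit : lunit X ∘ c 𝟙 = runit X
}.

Record CenterOb (C : MonCat) := {
  cob : C;
  hb : forall A : C, Hom (cob ⊗ A) (A ⊗ cob);
  hb_half : IsHalfBraiding hb
}.
Arguments cob {_} _.
Arguments hb {_} _ _.
Arguments hb_half {_} _.

Definition IsCenterHom {C : MonCat} (X Y : CenterOb C)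
    (f : Hom (cob X) (cob Y)) : Prop :=
  forall A : C, hb Y A ∘ (f ⊠ id A) = (id A ⊠ f) ∘ hb X A.

Arguments IsCenterHom {_} _ _ _.

Definition CenterHom {C : MonCat} (X Y : CenterOb C) : Type :=
  {f : Hom (cob X) (cob Y) | IsCenterHom X Y f}.

Lemma center_hom_eq {C : MonCat} (X Y : CenterOb C) (f g : CenterHom X Y) :
  proj1_sig f = proj1_sig g -> f = g.
Proof.
by case: f g => [f hf] [g hg] /= E; subst g; rewrite (proof_irrelevance _ hf hg).
Qed.

Lemma center_id_proof {C : MonCat} (X : CenterOb C) : IsCenterHom X X (id (cob X)).
Proof. by move=> A; rewrite !tens_id comp_id_l comp_id_r. Qed.

Lemma center_comp_proof {C : MonCat} (X Y Z : CenterOb C)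
    (g : CenterHom Y Z) (f : CenterHom X Y) :
  IsCenterHom X Z (proj1_sig g ∘ proj1_sig f).
Proof.
case: g f => [g hg] [f hf] A /=.
by rewrite tens_split_l tens_split_r (re2 (hg A)) comp_assoc hf comp_assoc.
Qed.

Definition center_id {C : MonCat} (X : CenterOb C) : CenterHom X X :=
  exist _ _ (center_id_proof X).
Definition center_comp {C : MonCat} (X Y Z : CenterOb C)
    (g : CenterHom Y Z) (f : CenterHom X Y) : CenterHom X Z :=
  exist _ _ (center_comp_proof g f).

Lemma center_comp_id_l {C : MonCat} (X Y : CenterOb C) (f : CenterHom X Y) :
  center_comp (center_id Y) f = f.
Proof. by apply: center_hom_eq; rewrite /= comp_id_l. Qed.
Lemma center_comp_id_r {C : MonCat} (X Y : CenterOb C) (f : CenterHom X Y) :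
  center_comp f (center_id X) = f.
Proof. by apply: center_hom_eq; rewrite /= comp_id_r. Qed.
Lemma center_comp_assoc {C : MonCat} (W X Y Z : CenterOb C)
    (h : CenterHom Y Z) (g : CenterHom X Y) (f : CenterHom W X) :
  center_comp (center_comp h g) f = center_comp h (center_comp g f).
Proof. by apply: center_hom_eq; rewrite /= comp_assoc. Qed.

Definition CenterCat (C : MonCat) : Category :=
  Build_Category center_comp_id_l center_comp_id_r (@center_comp_assoc C).

Lemma center_inv_proof {C : MonCat} (X Y : CenterOb C) (f : Hom (cob X) (cob Y))
    (fi : IsIso f) : IsCenterHom X Y f -> IsCenterHom Y X (inv fi).
Proof.
move=> hf A.
rewrite -[LHS]comp_id_l -tens_id -(inv_l fi) tens_split_r comp_assoc.
by rewrite (re2 (eq_sym (hf A))) comp_assoc -tens_split_l inv_r tens_id comp_id_r.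
Qed.

Definition center_iso {C : MonCat} (X Y : CenterOb C) (f : Hom (cob X) (cob Y))
    (hf : IsCenterHom X Y f) (fi : IsIso f) :
    @IsIso (CenterCat C) X Y (exist _ f hf).
Proof.
exists (exist _ (inv fi) (center_inv_proof fi hf)).
- by apply: center_hom_eq; apply: inv_l.
- by apply: center_hom_eq; apply: inv_r.
Defined.

Lemma assoc_l {C : MonCat} (X Y Z : C) : associnv X Y Z ∘ assoc X Y Z = id _.
Proof. exact: inv_l. Qed.
Lemma assoc_r {C : MonCat} (X Y Z : C) : assoc X Y Z ∘ associnv X Y Z = id _.
Proof. exact: inv_r. Qed.
Lemma lunit_l {C : MonCat} (X : C) : lunitinv X ∘ lunit X = id _.
Proof. exact: inv_l. Qed.
Lemma runit_l {C : MonCat} (X : C) : runitinv X ∘ runit X = id _.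
Proof. exact: inv_l. Qed.
Lemma runit_r {C : MonCat} (X : C) : runit X ∘ runitinv X = id _.
Proof. exact: inv_r. Qed.

Lemma iso_epi {C : Category} {X Y Z : C} (f : Hom X Y) (fi : IsIso f)
    (g h : Hom Y Z) : g ∘ f = h ∘ f -> g = h.
Proof.
move=> E; rewrite -[g]comp_id_r -[h]comp_id_r -(inv_r fi).
by rewrite -!comp_assoc E.
Qed.

Lemma iso_mono {C : Category} {X Y Z : C} (f : Hom Y Z) (fi : IsIso f)
    (g h : Hom X Y) : f ∘ g = f ∘ h -> g = h.
Proof.
move=> E; rewrite -[g]comp_id_l -[h]comp_id_l -(inv_l fi).
by rewrite !comp_assoc E.
Qed.

Definition iso_comp {C : Category} {X Y Z : C} (g : Hom Y Z) (f : Hom X Y) :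
  IsIso g -> IsIso f -> IsIso (g ∘ f).
Proof.
move=> gi fi; exists (inv fi ∘ inv gi).
- by rewrite comp_assoc (re2 (inv_l gi)) comp_id_l inv_l.
- by rewrite comp_assoc (re2 (inv_r fi)) comp_id_l inv_r.
Defined.

Definition iso_inv {C : Category} {X Y : C} (f : Hom X Y) (fi : IsIso f) :
  IsIso (inv fi).
Proof. exists f; [exact: inv_r | exact: inv_l]. Defined.

Definition iso_tens_l {C : MonCat} {X X' : C} (Y : C) (f : Hom X X') :
  IsIso f -> IsIso (f ⊠ id Y).
Proof.
move=> fi; exists (inv fi ⊠ id Y); rewrite -tens_comp comp_id_l.
- by rewrite inv_l tens_id.
- by rewrite inv_r tens_id.
Defined.

Definition iso_tens_r {C : MonCat} {X X' : C} (Y : C) (f : Hom X X') :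
  IsIso f -> IsIso (id Y ⊠ f).
Proof.
move=> fi; exists (id Y ⊠ inv fi); rewrite -tens_comp comp_id_l.
- by rewrite inv_l tens_id.
- by rewrite inv_r tens_id.
Defined.

Lemma associnv_nat {C : MonCat} (X X' Y Y' Z Z' : C)
    (f : Hom X X') (g : Hom Y Y') (h : Hom Z Z') :
  associnv X' Y' Z' ∘ (f ⊠ (g ⊠ h)) = ((f ⊠ g) ⊠ h) ∘ associnv X Y Z.
Proof.
apply: (iso_epi (assoc_iso X Y Z)); apply: (iso_mono (assoc_iso X' Y' Z')).
rewrite !comp_assoc assoc_l comp_id_r (re2 (assoc_r _ _ _)) comp_id_l.
by rewrite assoc_nat.
Qed.

Lemma tens_swap {C : MonCat} {X X' Y Y' : C} (f : Hom X X') (g : Hom Y Y') :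
  (f ⊠ id Y') ∘ (id X ⊠ g) = (id X' ⊠ g) ∘ (f ⊠ id Y).
Proof. by rewrite -!tens_comp !comp_id_l !comp_id_r. Qed.

Lemma pentagon_inv {C : MonCat} (W X Y Z : C) :
  (associnv W X Y ⊠ id Z) ∘ associnv W (X ⊗ Y) Z ∘ (id W ⊠ associnv X Y Z)
  = associnv (W ⊗ X) Y Z ∘ associnv W X (Y ⊗ Z).
Proof.
apply: (iso_epi (iso_tens_r W (assoc_iso X Y Z))).
rewrite !comp_assoc -tens_split_r assoc_l tens_id comp_id_r.
apply: (iso_epi (assoc_iso W (X ⊗ Y) Z)); rewrite !comp_assoc assoc_l comp_id_r.
apply: (iso_epi (iso_tens_l Z (assoc_iso W X Y))).
rewrite -tens_split_l assoc_l tens_id !comp_assoc.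
rewrite -pentagon (re2 (assoc_l _ _ _)) comp_id_l.
by rewrite assoc_l.
Qed.

Lemma pentagon_l {C : MonCat} (W X Y Z : C) :
  assoc W (X ⊗ Y) Z ∘ (assoc W X Y ⊠ id Z) ∘ associnv (W ⊗ X) Y Z
  = (id W ⊠ associnv X Y Z) ∘ assoc W X (Y ⊗ Z).
Proof.
apply: (iso_epi (assoc_iso (W ⊗ X) Y Z)); rewrite !comp_assoc assoc_l comp_id_r.
by rewrite pentagon (re2 (eq_sym (tens_split_r _ _))) assoc_l tens_id comp_id_l.
Qed.

Lemma pentagon_r {C : MonCat} (W X Y Z : C) :
  associnv W X (Y ⊗ Z) ∘ (id W ⊠ assoc X Y Z) ∘ assoc W (X ⊗ Y) Z
  = assoc (W ⊗ X) Y Z ∘ (associnv W X Y ⊠ id Z).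
Proof.
apply: (iso_epi (iso_tens_l Z (assoc_iso W X Y))).
rewrite !comp_assoc -tens_split_l assoc_l tens_id comp_id_r.
by rewrite -pentagon (re2 (assoc_l _ _ _)) comp_id_l.
Qed.

Lemma lunit_inj {C : MonCat} (X Y : C) (f g : Hom X Y) :
  id (@munit C) ⊠ f = id 𝟙 ⊠ g -> f = g.
Proof.
move=> E; apply: (iso_epi (lunit_iso X)).
by rewrite -!lunit_nat E.
Qed.

Lemma runit_inj {C : MonCat} (X Y : C) (f g : Hom X Y) :
  f ⊠ id (@munit C) = g ⊠ id 𝟙 -> f = g.
Proof.
move=> E; apply: (iso_epi (runit_iso X)).
by rewrite -!runit_nat E.
Qed.

Lemma lunit_tens {C : MonCat} (X Y : C) :
  lunit (X ⊗ Y) ∘ assoc 𝟙 X Y = lunit X ⊠ id Y.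
Proof.
apply: lunit_inj; rewrite tens_split_r.
apply: (iso_epi (assoc_iso 𝟙 (𝟙 ⊗ X) Y)).
apply: (iso_epi (iso_tens_l Y (assoc_iso 𝟙 𝟙 X))).
rewrite !comp_assoc -pentagon (re2 (triangle _ _)).
rewrite (re2 (eq_sym (assoc_nat _ _ _))) comp_assoc -tens_split_l triangle.
by rewrite -tens_id -assoc_nat.
Qed.

Lemma runit_tens {C : MonCat} (X Y : C) :
  (id X ⊠ runit Y) ∘ assoc X Y 𝟙 = runit (X ⊗ Y).
Proof.
apply: runit_inj; rewrite tens_split_l.
apply: (iso_mono (assoc_iso X Y 𝟙)).
rewrite (re2 (assoc_nat _ _ _)) -triangle tens_split_r !comp_assoc.
by rewrite -pentagon (re2 (eq_sym (assoc_nat _ _ _))) tens_id comp_assoc triangle.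
Qed.

Lemma lunit_runit_unit {C : MonCat} : lunit (@munit C) = runit 𝟙.
Proof.
apply: runit_inj.
rewrite -lunit_tens -triangle; congr (_ ∘ _).
apply: (iso_mono (lunit_iso 𝟙)); by rewrite lunit_nat.
Qed.

Definition center_unit_hb {C : MonCat} (A : C) : Hom (𝟙 ⊗ A) (A ⊗ 𝟙) :=
  runitinv A ∘ lunit A.

Lemma runitinv_nat {C : MonCat} (A B : C) (f : Hom A B) :
  runitinv B ∘ f = (f ⊠ id 𝟙) ∘ runitinv A.
Proof.
apply: (iso_mono (runit_iso B)).
by rewrite (re2 (runit_r _)) (re2 (runit_nat _)) comp_id_l comp_assoc runit_r comp_id_r.
Qed.

Definition center_unit_half {C : MonCat} : IsHalfBraiding (@center_unit_hb C).
Proof.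
split.
- by move=> A; apply: iso_comp; [apply: iso_inv | apply: lunit_iso].
- move=> A B f; rewrite /center_unit_hb comp_assoc lunit_nat.
  by rewrite (re2 (runitinv_nat _)) comp_assoc.
- move=> A B; rewrite /center_unit_hb comp_assoc lunit_tens.
  rewrite tens_split_l tens_split_r !comp_assoc (re2 (triangle _ _)).
  rewrite (re2 (eq_sym (tens_split_l _ _))) runit_r tens_id comp_id_l.
  apply: (iso_mono (iso_tens_r A (runit_iso B))).
  rewrite (re2 (runit_tens _ _)) (re2 (runit_r _)) comp_id_l.
  by rewrite (re2 (eq_sym (tens_split_r _ _))) runit_r tens_id comp_id_l.
- by rewrite /center_unit_hb lunit_runit_unit runit_l comp_id_r.
Defined.

Definition center_unit {C : MonCat} : CenterOb C := Build_CenterOb (@center_unit_half C).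

Definition center_tens_hb {C : MonCat} (X Y : CenterOb C) (A : C) :
    Hom ((cob X ⊗ cob Y) ⊗ A) (A ⊗ (cob X ⊗ cob Y)) :=
  assoc A (cob X) (cob Y) ∘ (hb X A ⊠ id (cob Y)) ∘ associnv (cob X) A (cob Y)
  ∘ (id (cob X) ⊠ hb Y A) ∘ assoc (cob X) (cob Y) A.

Lemma center_tens_hexagon {C : MonCat} (X Y : CenterOb C) (A B : C) :
  assoc A B (cob X ⊗ cob Y) ∘ center_tens_hb X Y (A ⊗ B) ∘ assoc (cob X ⊗ cob Y) A B
  = (id A ⊠ center_tens_hb X Y B) ∘ assoc A (cob X ⊗ cob Y) B
    ∘ (center_tens_hb X Y A ⊠ id B).
Proof.
case: X Y => [X c hc] [Y d hd]; rewrite /center_tens_hb /=.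
rewrite !tens_split_l !tens_split_r !comp_assoc.
rewrite pentagon (re2 (pentagon _ _ _ _)) !comp_assoc.
have Hc : assoc A B X ∘ c (A ⊗ B)
    = ((id A ⊠ c B) ∘ assoc A X B ∘ (c A ⊠ id B)) ∘ associnv X A B.
  by rewrite -(hb_tens hc) !comp_assoc assoc_r comp_id_r.
have Hd : d (A ⊗ B) ∘ assoc Y A B
    = associnv A B Y ∘ (id A ⊠ d B) ∘ assoc A Y B ∘ (d A ⊠ id B).
  by rewrite -(hb_tens hd) (re2 (assoc_l _ _ _)) comp_id_l.
rewrite (re2 (eq_sym (tens_split_l _ _))) Hc !tens_split_l.
rewrite [_ ∘ (id X ⊠ assoc Y A B) ∘ _](re2 (eq_sym (tens_split_r _ _))) Hd.
rewrite !tens_split_r !comp_assoc.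
congr (_ ∘ _).
rewrite (re2 (assoc_nat _ _ _)) comp_assoc; congr (_ ∘ _).
rewrite (re3 (pentagon_inv _ _ _ _)) !comp_assoc.
rewrite (re2 (associnv_nat _ _ _)).
rewrite (re2 (eq_sym (associnv_nat _ _ _))) !tens_id !comp_assoc.
rewrite (re2 (tens_swap _ _)) !comp_assoc.
rewrite (re3 (pentagon_l _ _ _ _)) !comp_assoc; congr (_ ∘ _).
rewrite -tens_id (re2 (assoc_nat _ _ _)) comp_assoc; congr (_ ∘ _).
rewrite (re2 (eq_sym (assoc_nat _ _ _))) comp_assoc (re3 (pentagon_r _ _ _ _)) comp_assoc.
rewrite -(tens_id Y B) (re2 (eq_sym (assoc_nat _ _ _))) !comp_assoc.
by rewrite (re2 (pentagon _ _ _ _)) !comp_assoc.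
Qed.

Definition center_tens_half {C : MonCat} (X Y : CenterOb C) :
  IsHalfBraiding (center_tens_hb X Y).
Proof.
split.
- move=> A; rewrite /center_tens_hb.
  apply: (iso_comp (assoc_iso _ _ _)).
  apply: (iso_comp (iso_tens_l _ (hb_iso (hb_half X) A))).
  apply: (iso_comp (iso_inv (assoc_iso _ _ _))).
  apply: (iso_comp (iso_tens_r _ (hb_iso (hb_half Y) A))).
  exact: assoc_iso.
- move=> A B f; rewrite /center_tens_hb !comp_assoc -tens_id assoc_nat.
  rewrite (re2 (eq_sym (tens_split_r _ _))) (hb_nat (hb_half Y)) tens_split_r !comp_assoc.
  rewrite (re2 (associnv_nat _ _ _)) comp_assoc.
  rewrite (re2 (eq_sym (tens_split_l _ _))) (hb_nat (hb_half X)) tens_split_l !comp_assoc.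
  by rewrite (re2 (assoc_nat _ _ _)) tens_id comp_assoc.
- exact: center_tens_hexagon.
- rewrite /center_tens_hb (re2 (lunit_tens _ _)).
  rewrite (re2 (eq_sym (tens_split_l _ _))) (hb_unit (hb_half X)) -triangle comp_assoc.
  rewrite (re2 (assoc_r _ _ _)) comp_id_l.
  by rewrite (re2 (eq_sym (tens_split_r _ _))) (hb_unit (hb_half Y)) runit_tens.
Defined.

Definition center_tens {C : MonCat} (X Y : CenterOb C) : CenterOb C :=
  Build_CenterOb (center_tens_half X Y).

Lemma center_tens_hom_proof {C : MonCat} (X X' Y Y' : CenterOb C)
    (f : CenterHom X X') (g : CenterHom Y Y') :
  IsCenterHom (center_tens X Y) (center_tens X' Y') (proj1_sig f ⊠ proj1_sig g).
Proof.
case: f g => [f hf] [g hg] A /=; rewrite /center_tens_hb !comp_assoc.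
rewrite assoc_nat (re2 (eq_sym (tens_comp _ _ _ _))) hg comp_id_l.
have -> : f ⊠ ((id A ⊠ g) ∘ hb Y A) = (f ⊠ (id A ⊠ g)) ∘ (id (cob X) ⊠ hb Y A).
  by rewrite -tens_comp comp_id_r.
rewrite comp_assoc (re2 (associnv_nat _ _ _)) comp_assoc.
rewrite (re2 (eq_sym (tens_comp _ _ _ _))) hf comp_id_l.
have -> : ((id A ⊠ f) ∘ hb X A) ⊠ g = ((id A ⊠ f) ⊠ g) ∘ (hb X A ⊠ id (cob Y)).
  by rewrite -tens_comp comp_id_r.
by rewrite comp_assoc (re2 (assoc_nat _ _ _)) comp_assoc.
Qed.

Definition center_tens_hom {C : MonCat} (X X' Y Y' : CenterCat C)
    (f : Hom X X') (g : Hom Y Y') :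
    @Hom (CenterCat C) (center_tens X Y) (center_tens X' Y') :=
  exist _ _ (center_tens_hom_proof f g).

Lemma center_assoc_proof {C : MonCat} (X Y Z : CenterOb C) :
  IsCenterHom (center_tens (center_tens X Y) Z) (center_tens X (center_tens Y Z))
    (assoc (cob X) (cob Y) (cob Z)).
Proof.
case: X Y Z => [X c hc] [Y d hd] [Z e he] A /=; rewrite /center_tens_hb /=.
rewrite /center_tens_hb /= !tens_split_l !tens_split_r !comp_assoc.
rewrite (re3 (eq_sym (pentagon _ _ _ _))) -pentagon !comp_assoc; congr (_ ∘ _).
rewrite -(tens_id X Y) (re2 (eq_sym (assoc_nat _ _ _))) !comp_assoc.
rewrite (re2 (eq_sym (pentagon_l _ _ _ _))) !comp_assoc.
rewrite (re2 (eq_sym (assoc_nat _ _ _))) !comp_assoc.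
rewrite (re3 (pentagon_r _ _ _ _)) !comp_assoc.
by rewrite -tens_id (re2 (eq_sym (assoc_nat _ _ _))) !comp_assoc.
Qed.

Lemma center_lunit_proof {C : MonCat} (X : CenterOb C) :
  IsCenterHom (center_tens center_unit X) X (lunit (cob X)).
Proof.
case: X => [X c hc] A /=; rewrite /center_tens_hb /= /center_unit_hb.
rewrite tens_split_l !comp_assoc (re2 (triangle _ _)).
rewrite (re2 (eq_sym (tens_split_l _ _))) runit_r tens_id comp_id_l.
rewrite -(lunit_tens A X) !comp_assoc (re2 (assoc_r _ _ _)) comp_id_l.
by rewrite (re2 (lunit_nat _)) comp_assoc lunit_tens.
Qed.

Lemma center_runit_proof {C : MonCat} (X : CenterOb C) :
  IsCenterHom (center_tens X center_unit) X (runit (cob X)).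
Proof.
case: X => [X c hc] A /=; rewrite /center_tens_hb /= /center_unit_hb.
rewrite tens_split_r !comp_assoc triangle (re2 (runit_tens _ _)).
rewrite (re2 (runit_nat _)) !comp_assoc; congr (_ ∘ _).
rewrite -(re2 (runit_tens _ _)) (re2 (assoc_r _ _ _)) comp_id_l.
by rewrite (re2 (eq_sym (tens_split_r _ _))) runit_r tens_id comp_id_l.
Qed.

Definition CenterMon (C : MonCat) : MonCat.
Proof.
refine (@Build_MonCat (CenterCat C) center_tens (@center_tens_hom C) center_unit
  (fun X Y Z => exist _ _ (center_assoc_proof X Y Z))
  (fun X => exist _ _ (center_lunit_proof X))
  (fun X => exist _ _ (center_runit_proof X))
  (fun X Y Z => center_iso (center_assoc_proof X Y Z) (assoc_iso _ _ _))
  (fun X => center_iso (center_lunit_proof X) (lunit_iso _))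
  (fun X => center_iso (center_runit_proof X) (runit_iso _))
  _ _ _ _ _ _ _); intros; apply: center_hom_eq => /=.
- exact: tens_id.
- exact: tens_comp.
- exact: assoc_nat.
- exact: lunit_nat.
- exact: runit_nat.
- exact: pentagon.
- exact: triangle.
Defined.

Lemma center_braiding_proof {C : MonCat} (X Y : CenterOb C) :
  IsCenterHom (center_tens X Y) (center_tens Y X) (hb X (cob Y)).
Proof.
case: X Y => [X c hc] [Y d hd] A /=; rewrite /center_tens_hb /= !comp_assoc.
have HA : (id A ⊠ c Y) ∘ assoc A X Y ∘ (c A ⊠ id Y) ∘ associnv X A Y
    = assoc A Y X ∘ c (A ⊗ Y).
  by rewrite (re3 (eq_sym (hb_tens hc _ _))) !comp_assoc assoc_r comp_id_r.
have HY : assoc Y A X ∘ c (Y ⊗ A) ∘ assoc X Y A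
    = (id Y ⊠ c A) ∘ assoc Y X A ∘ (c Y ⊠ id A) by exact: hb_tens.
rewrite -HY (re2 (assoc_l _ _ _)) comp_id_l.
rewrite (re2 (eq_sym (hb_nat hc _))) comp_assoc.
have E := f_equal (fun h => h ∘ (id X ⊠ d A) ∘ assoc X Y A) HA.
by move: E; rewrite /= !comp_assoc => ->.
Qed.

Definition Center (C : MonCat) : BraidedCat.
Proof.
refine (@Build_BraidedCat (CenterMon C)
  (fun X Y => exist _ _ (center_braiding_proof X Y))
  (fun X Y => center_iso (center_braiding_proof X Y) (hb_iso (hb_half X) (cob Y)))
  _ _ _); intros; apply: center_hom_eq => /=.
- case: f g => [f hf] [g hg] /=.
  have -> : f ⊠ g = (f ⊠ id _) ∘ (id _ ⊠ g) by rewrite -tens_comp comp_id_l comp_id_r.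
  rewrite (re2 (hf _)) comp_assoc (hb_nat (hb_half X)) -comp_assoc; congr (_ ∘ _).
  by rewrite -tens_comp comp_id_l comp_id_r.
- exact: (hb_tens (hb_half X)).
- rewrite /center_tens_hb /associnv /= !comp_assoc (re2 (inv_l _)) comp_id_l.
  by rewrite inv_r comp_id_r.
Defined.

Definition induced_hb {D C : MonCat} {L : OplaxFunctor D C} {G : OplaxFunctor C D}
    {adj : OpmonoidalAdjunction L G} (pf : ProjectionFormula adj)
    (X : CenterOb D) (A : C) : Hom (L (cob X) ⊗ A) (A ⊗ L (cob X)) :=
  lproj adj A (cob X) ∘ fmap L (hb X (G A)) ∘ inv (rproj_iso pf (cob X) A).

(* Main.v *)
(* The induced half-braiding is characterised by c^L_A ∘ rproj = lproj ∘ L(c_{GA}),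
   and every identity about it is checked after precomposing with the invertible
   rproj.  Coassociativity of oplax^L makes lproj, rproj and oplax^L slide past one
   another, and monoidality of the counit makes lproj and rproj multiplicative in
   A; this carries the hexagon, and the compatibility with oplax^L, over from D to
   C.  The braiding axiom follows because rproj_{X,LY} ∘ L(X ⊗ unit_Y) = oplax^L_{X,Y}
   by a triangle identity. *)

From Stdlib Require Import ssreflect.
Require Import Defs.
Local Open Scope cat_scope.

(** * Functor laws, naturality and coassociativity of oplax structures *)

Lemma fmap_id {C D : Category} (F : Functor C D) (X : C) :
  fmap F (id X) = id (F X).
Proof. exact: law_id (functor_laws F) X. Qed.

Lemma fmap_comp {C D : Category} (F : Functor C D) {X Y Z : C}
    (g : Hom Y Z) (f : Hom X Y) :
  fmap F (g ∘ f) = fmap F g ∘ fmap F f.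
Proof. exact: law_comp (functor_laws F) X Y Z g f. Qed.

Definition iso_fmap {C D : Category} (F : Functor C D) {X Y : C} {f : Hom X Y}
    (fi : IsIso f) : IsIso (fmap F f).
Proof.
exists (fmap F (inv fi)); rewrite -fmap_comp.
- by rewrite inv_l fmap_id.
- by rewrite inv_r fmap_id.
Defined.

Lemma oplax_nat {C D : MonCat} (F : OplaxFunctor C D) {X X' Y Y' : C}
    (f : Hom X X') (g : Hom Y Y') :
  oplax F X' Y' ∘ fmap F (f ⊠ g) = (fmap F f ⊠ fmap F g) ∘ oplax F X Y.
Proof. exact: law_nat (oplax_laws F) _ _ _ _ f g. Qed.

Lemma oplax_nat_l {C D : MonCat} (F : OplaxFunctor C D) {X X' : C} (Y : C)
    (f : Hom X X') :
  oplax F X' Y ∘ fmap F (f ⊠ id Y) = (fmap F f ⊠ id (F Y)) ∘ oplax F X Y.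
Proof. by rewrite oplax_nat fmap_id. Qed.

Lemma oplax_nat_r {C D : MonCat} (F : OplaxFunctor C D) (X : C) {Y Y' : C}
    (f : Hom Y Y') :
  oplax F X Y' ∘ fmap F (id X ⊠ f) = (id (F X) ⊠ fmap F f) ∘ oplax F X Y.
Proof. by rewrite oplax_nat fmap_id. Qed.

(* The projection morphisms and the structure maps are all of the form
   [(f ⊠ g) ∘ oplax], so this covers every compatibility between them. *)
Lemma oplax_assoc_tens {C D : MonCat} (F : OplaxFunctor C D) {X Y Z : C}
    {U V W : D} (f : Hom (F X) U) (g : Hom (F Y) V) (h : Hom (F Z) W) :
  assoc U V W ∘ (((f ⊠ g) ∘ oplax F X Y) ⊠ h) ∘ oplax F (X ⊗ Y) Z
  = (f ⊠ ((g ⊠ h) ∘ oplax F Y Z)) ∘ oplax F X (Y ⊗ Z) ∘ fmap F (assoc X Y Z).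
Proof.
have -> : ((f ⊠ g) ∘ oplax F X Y) ⊠ h
    = ((f ⊠ g) ⊠ h) ∘ (oplax F X Y ⊠ id (F Z)) by rewrite -tens_comp comp_id_r.
have -> : f ⊠ ((g ⊠ h) ∘ oplax F Y Z)
    = (f ⊠ (g ⊠ h)) ∘ (id (F X) ⊠ oplax F Y Z) by rewrite -tens_comp comp_id_r.
rewrite !comp_assoc (re2 (assoc_nat _ _ _)) !comp_assoc.
by rewrite (law_assoc (oplax_laws F)).
Qed.

(** Puts a bare [oplax] into the shape that [oplax_assoc_tens] expects, with identities as
    factors. *)
Lemma oplax_as_proj {C D : MonCat} (F : OplaxFunctor C D) (X Y : C) :
  oplax F X Y = (id (F X) ⊠ id (F Y)) ∘ oplax F X Y.
Proof. by rewrite tens_id comp_id_l. Qed.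

(** * Naturality of the projection morphisms in both variables *)

Lemma lproj_nat_l {D C : MonCat} {L : OplaxFunctor D C} {G : OplaxFunctor C D}
    (adj : OpmonoidalAdjunction L G) {A B : C} (f : Hom A B) (X : D) :
  lproj adj B X ∘ fmap L (fmap G f ⊠ id X) = (f ⊠ id (L X)) ∘ lproj adj A X.
Proof.
rewrite /lproj comp_assoc oplax_nat_l -!comp_assoc -!tens_split_l.
by rewrite (adj_counit_nat adj f).
Qed.

Lemma rproj_nat_r {D C : MonCat} {L : OplaxFunctor D C} {G : OplaxFunctor C D}
    (adj : OpmonoidalAdjunction L G) (X : D) {A B : C} (f : Hom A B) :
  rproj adj X B ∘ fmap L (id X ⊠ fmap G f) = (id (L X) ⊠ f) ∘ rproj adj X A.
Proof.
rewrite /rproj comp_assoc oplax_nat_r -!comp_assoc -!tens_split_r.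
by rewrite (adj_counit_nat adj f).
Qed.

Lemma lproj_nat_r {D C : MonCat} {L : OplaxFunctor D C} {G : OplaxFunctor C D}
    (adj : OpmonoidalAdjunction L G) (A : C) {X Y : D} (f : Hom X Y) :
  lproj adj A Y ∘ fmap L (id (G A) ⊠ f) = (id A ⊠ fmap L f) ∘ lproj adj A X.
Proof. by rewrite /lproj comp_assoc oplax_nat_r (re2 (tens_swap _ _)) comp_assoc. Qed.

Lemma rproj_nat_l {D C : MonCat} {L : OplaxFunctor D C} {G : OplaxFunctor C D}
    (adj : OpmonoidalAdjunction L G) {X Y : D} (f : Hom X Y) (A : C) :
  rproj adj Y A ∘ fmap L (f ⊠ id (G A)) = (fmap L f ⊠ id A) ∘ rproj adj X A.
Proof.
by rewrite /rproj comp_assoc oplax_nat_l (re2 (eq_sym (tens_swap _ _))) comp_assoc.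
Qed.

(** * Projection morphisms and tensor products *)

Lemma counit_tens {D C : MonCat} {L : OplaxFunctor D C} {G : OplaxFunctor C D}
    (adj : OpmonoidalAdjunction L G) (A B : C) :
  adj_counit adj (A ⊗ B)
  = (adj_counit adj A ⊠ adj_counit adj B) ∘ oplax L (G A) (G B)
    ∘ fmap L (oplax G A B).
Proof.
by have := monoidal_tens (counit_monoidal adj) A B; rewrite /= comp_id_l.
Qed.

Lemma counit_unit {D C : MonCat} {L : OplaxFunctor D C} {G : OplaxFunctor C D}
    (adj : OpmonoidalAdjunction L G) :
  adj_counit adj 𝟙 = oplax0 L ∘ fmap L (oplax0 G).
Proof. by have := monoidal_unit (counit_monoidal adj); rewrite /= comp_id_l. Qed.

(** Coassociativity with the counit on the first factor. The next three laws put it on the third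
    factor, on the second, and on the first and third. *)
Lemma oplax_lproj {D C : MonCat} {L : OplaxFunctor D C} {G : OplaxFunctor C D}
    (adj : OpmonoidalAdjunction L G) (A : C) (X Y : D) :
  assoc A (L X) (L Y) ∘ (lproj adj A X ⊠ id (L Y)) ∘ oplax L (G A ⊗ X) Y
  = (id A ⊠ oplax L X Y) ∘ lproj adj A (X ⊗ Y) ∘ fmap L (assoc (G A) X Y).
Proof.
rewrite oplax_assoc_tens -oplax_as_proj /lproj -!comp_assoc; do 2 congr (_ ∘ _).
by rewrite -tens_comp comp_id_l comp_id_r.
Qed.

Lemma oplax_rproj {D C : MonCat} {L : OplaxFunctor D C} {G : OplaxFunctor C D}
    (adj : OpmonoidalAdjunction L G) (X Y : D) (A : C) :
  assoc (L X) (L Y) A ∘ (oplax L X Y ⊠ id A) ∘ rproj adj (X ⊗ Y) A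
  = (id (L X) ⊠ rproj adj Y A) ∘ oplax L X (Y ⊗ G A)
    ∘ fmap L (assoc X Y (G A)).
Proof.
rewrite -oplax_assoc_tens -oplax_as_proj /rproj (re2 (eq_sym (tens_comp _ _ _ _))).
by rewrite comp_id_l comp_id_r.
Qed.

Lemma rproj_oplax_lproj {D C : MonCat} {L : OplaxFunctor D C}
    {G : OplaxFunctor C D} (adj : OpmonoidalAdjunction L G) (X Y : D) (A : C) :
  assoc (L X) A (L Y) ∘ (rproj adj X A ⊠ id (L Y)) ∘ oplax L (X ⊗ G A) Y
  = (id (L X) ⊠ lproj adj A Y) ∘ oplax L X (G A ⊗ Y)
    ∘ fmap L (assoc X (G A) Y).
Proof. exact: oplax_assoc_tens. Qed.

Lemma lproj_rproj {D C : MonCat} {L : OplaxFunctor D C} {G : OplaxFunctor C D}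
    (adj : OpmonoidalAdjunction L G) (A B : C) (X : D) :
  assoc A (L X) B ∘ (lproj adj A X ⊠ id B) ∘ rproj adj (G A ⊗ X) B
  = (id A ⊠ rproj adj X B) ∘ lproj adj A (X ⊗ G B)
    ∘ fmap L (assoc (G A) X (G B)).
Proof.
rewrite /rproj (re2 (eq_sym (tens_comp _ _ _ _))) comp_id_l comp_id_r.
rewrite oplax_assoc_tens /lproj comp_assoc (re2 (eq_sym (tens_comp _ _ _ _))).
by rewrite comp_id_l comp_id_r.
Qed.

(** Monoidality of the counit splits it at [A ⊗ B] into two counits after [oplax G A B];
    coassociativity of [L] then distributes them over two nested projections. *)
Lemma rproj_tens {D C : MonCat} {L : OplaxFunctor D C} {G : OplaxFunctor C D}
    (adj : OpmonoidalAdjunction L G) (X : D) (A B : C) :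
  rproj adj X (A ⊗ B)
  = assoc (L X) A B ∘ (rproj adj X A ⊠ id B) ∘ rproj adj (X ⊗ G A) B
    ∘ fmap L (associnv X (G A) (G B) ∘ (id X ⊠ oplax G A B)).
Proof.
(* Only the projection at [X ⊗ G A] is unfolded: its counit merges with [rproj adj X A ⊠ id B] into
   one tensor, to which coassociativity applies. *)
rewrite {3}/rproj comp_assoc (re2 (eq_sym (tens_comp _ _ _ _))) comp_id_l comp_id_r.
rewrite (re3 (oplax_assoc_tens _ _ _ _)) !comp_assoc -fmap_comp.
rewrite (re2 (assoc_r _ _ _)) comp_id_l oplax_nat_r.
by rewrite (re2 (eq_sym (tens_comp _ _ _ _))) comp_id_r comp_assoc -counit_tens.
Qed.

Lemma lproj_tens {D C : MonCat} {L : OplaxFunctor D C} {G : OplaxFunctor C D}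
    (adj : OpmonoidalAdjunction L G) (A B : C) (X : D) :
  assoc A B (L X) ∘ lproj adj (A ⊗ B) X
  = (id A ⊠ lproj adj B X) ∘ lproj adj A (G B ⊗ X)
    ∘ fmap L (assoc (G A) (G B) X ∘ (oplax G A B ⊠ id X)).
Proof.
rewrite {3}/lproj comp_assoc (re2 (eq_sym (tens_comp _ _ _ _))) comp_id_l comp_id_r.
rewrite fmap_comp (re3 (eq_sym (oplax_assoc_tens _ _ _ _))) !comp_assoc oplax_nat_l.
by rewrite (re2 (eq_sym (tens_split_l _ _))) comp_assoc -counit_tens.
Qed.

(** * Projection morphisms at unit objects and along the adjunction unit *)

Lemma lproj_unit {D C : MonCat} {L : OplaxFunctor D C} {G : OplaxFunctor C D}
    (adj : OpmonoidalAdjunction L G) (X : D) :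
  lunit (L X) ∘ lproj adj 𝟙 X = fmap L (lunit X ∘ (oplax0 G ⊠ id X)).
Proof.
rewrite /lproj counit_unit tens_split_l comp_assoc -oplax_nat_l.
by rewrite fmap_comp -(law_lunit (oplax_laws L)) !comp_assoc.
Qed.

Lemma rproj_unit {D C : MonCat} {L : OplaxFunctor D C} {G : OplaxFunctor C D}
    (adj : OpmonoidalAdjunction L G) (X : D) :
  runit (L X) ∘ rproj adj X 𝟙 = fmap L (runit X ∘ (id X ⊠ oplax0 G)).
Proof.
rewrite /rproj counit_unit tens_split_r comp_assoc -oplax_nat_r.
by rewrite fmap_comp -(law_runit (oplax_laws L)) !comp_assoc.
Qed.

(** The right unit law of [L]. With its mirror image [oplax0_rproj] it gives the compatibility of
    [oplax0 L] with the half-braidings of the unit objects. *)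
Lemma oplax0_lproj {D C : MonCat} {L : OplaxFunctor D C} {G : OplaxFunctor C D}
    (adj : OpmonoidalAdjunction L G) (A : C) :
  runit A ∘ (id A ⊠ oplax0 L) ∘ lproj adj A 𝟙
  = adj_counit adj A ∘ fmap L (runit (G A)).
Proof.
rewrite /lproj (re2 (eq_sym (tens_swap _ _))) comp_assoc (re2 (runit_nat _)) comp_assoc.
by rewrite (law_runit (oplax_laws L)).
Qed.

Lemma oplax0_rproj {D C : MonCat} {L : OplaxFunctor D C} {G : OplaxFunctor C D}
    (adj : OpmonoidalAdjunction L G) (A : C) :
  lunit A ∘ (oplax0 L ⊠ id A) ∘ rproj adj 𝟙 A
  = adj_counit adj A ∘ fmap L (lunit (G A)).
Proof.
rewrite /rproj (re2 (tens_swap _ _)) comp_assoc (re2 (lunit_nat _)) comp_assoc.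
by rewrite (law_lunit (oplax_laws L)).
Qed.

Lemma lproj_adj_unit {D C : MonCat} {L : OplaxFunctor D C} {G : OplaxFunctor C D}
    (adj : OpmonoidalAdjunction L G) (X Y : D) :
  lproj adj (L X) Y ∘ fmap L (adj_unit adj X ⊠ id Y) = oplax L X Y.
Proof.
rewrite /lproj comp_assoc oplax_nat_l (re2 (eq_sym (tens_split_l _ _))).
by rewrite (adj_triangle_l adj) tens_id comp_id_l.
Qed.

Lemma rproj_adj_unit {D C : MonCat} {L : OplaxFunctor D C} {G : OplaxFunctor C D}
    (adj : OpmonoidalAdjunction L G) (X Y : D) :
  rproj adj X (L Y) ∘ fmap L (id X ⊠ adj_unit adj Y) = oplax L X Y.
Proof.
rewrite /rproj comp_assoc oplax_nat_r (re2 (eq_sym (tens_split_r _ _))).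
by rewrite (adj_triangle_l adj) tens_id comp_id_l.
Qed.

(** * The induced half-braiding and its axioms *)

Lemma induced_hb_rproj {D C : MonCat} {L : OplaxFunctor D C}
    {G : OplaxFunctor C D} {adj : OpmonoidalAdjunction L G}
    (pf : ProjectionFormula adj) (X : CenterOb D) (A : C) :
  induced_hb pf X A ∘ rproj adj (cob X) A
  = lproj adj A (cob X) ∘ fmap L (hb X (G A)).
Proof. by rewrite /induced_hb !comp_assoc inv_l comp_id_r. Qed.

Definition induced_hb_iso {D C : MonCat} {L : OplaxFunctor D C}
    {G : OplaxFunctor C D} {adj : OpmonoidalAdjunction L G}
    (pf : ProjectionFormula adj) (X : CenterOb D) (A : C) :
  IsIso (induced_hb pf X A).
Proof.
apply: (iso_comp (lproj_iso pf A (cob X))).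
exact: (iso_comp (iso_fmap L (hb_iso (hb_half X) (G A)))
                 (iso_inv (rproj_iso pf (cob X) A))).
Defined.

(* Unlike SSReflect's [rewrite !comp_assoc], this does not unfold the composites
   [lproj], [rproj] and [induced_hb]. *)
Local Opaque lproj rproj induced_hb.
Local Ltac rassoc := rewrite -> ?comp_assoc.

Lemma induced_hb_nat {D C : MonCat} {L : OplaxFunctor D C}
    {G : OplaxFunctor C D} {adj : OpmonoidalAdjunction L G}
    (pf : ProjectionFormula adj) (X : CenterOb D) (A B : C) (f : Hom A B) :
  induced_hb pf X B ∘ (id (L (cob X)) ⊠ f)
  = (f ⊠ id (L (cob X))) ∘ induced_hb pf X A.
Proof.
apply: (iso_epi (rproj_iso pf (cob X) A)); rassoc; rewrite induced_hb_rproj.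
rewrite -rproj_nat_r (re2 (induced_hb_rproj _ _ _)); rassoc; rewrite -fmap_comp.
by rewrite (hb_nat (hb_half X)) fmap_comp (re2 (lproj_nat_l _ _ _)); rassoc.
Qed.

Lemma induced_hb_tens {D C : MonCat} {L : OplaxFunctor D C}
    {G : OplaxFunctor C D} {adj : OpmonoidalAdjunction L G}
    (pf : ProjectionFormula adj) (X : CenterOb D) (A B : C) :
  assoc A B (L (cob X)) ∘ induced_hb pf X (A ⊗ B) ∘ assoc (L (cob X)) A B
  = (id A ⊠ induced_hb pf X B) ∘ assoc A (L (cob X)) B
    ∘ (induced_hb pf X A ⊠ id B).
Proof.
(* Precomposing also with the inverse associator cancels the rightmost [assoc] on the left side and
   the one produced by [rproj_tens] on the right. *)
apply: (iso_epi (iso_comp (iso_inv (assoc_iso (L (cob X)) A B))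
                          (rproj_iso pf (cob X) (A ⊗ B)))).
rewrite -/(associnv _ _ _); rassoc; rewrite (re2 (assoc_r _ _ _)) comp_id_l.
rewrite induced_hb_rproj (re2 (lproj_tens _ _ _ _)) rproj_tens.
rewrite (re2 (assoc_l _ _ _)) comp_id_l.
rewrite (re2 (eq_sym (tens_split_l _ _))) induced_hb_rproj tens_split_l; rassoc.
rewrite (re2 (eq_sym (rproj_nat_l _ _ _))); rassoc.
rewrite (re3 (lproj_rproj _ _ _ _)); rassoc.
rewrite (re2 (eq_sym (tens_split_r _ _))) induced_hb_rproj tens_split_r; rassoc.
rewrite (re2 (eq_sym (lproj_nat_r _ _ _))); rassoc.
(* Both sides now start with the same two left projections; what remains is an identity in [D] under
   [L]. *)
do 2 congr (_ ∘ _); rewrite -!fmap_comp; congr (fmap L _).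
(* Naturality of the half-braiding of [X] at [oplax G A B] reduces the claim to its hexagon at [G A]
   and [G B]. *)
rassoc; rewrite -(hb_nat (hb_half X)).
have := f_equal (fun h => h ∘ associnv _ _ _) (hb_tens (hb_half X) (G A) (G B)).
simpl; rassoc; rewrite assoc_r comp_id_r => H.
by rewrite (re2 H); rassoc.
Qed.

Lemma induced_hb_unit {D C : MonCat} {L : OplaxFunctor D C}
    {G : OplaxFunctor C D} {adj : OpmonoidalAdjunction L G}
    (pf : ProjectionFormula adj) (X : CenterOb D) :
  lunit (L (cob X)) ∘ induced_hb pf X 𝟙 = runit (L (cob X)).
Proof.
apply: (iso_epi (rproj_iso pf (cob X) 𝟙)); rassoc; rewrite induced_hb_rproj.
rewrite (re2 (lproj_unit _ _)) rproj_unit -fmap_comp; rassoc.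
(* Naturality at [oplax0 G] moves the half-braiding from [G 𝟙] to [𝟙], where the unit axiom
   applies. *)
by rewrite -(hb_nat (hb_half X)) (re2 (hb_unit (hb_half X))).
Qed.

Definition induced_half {D C : MonCat} {L : OplaxFunctor D C}
    {G : OplaxFunctor C D} {adj : OpmonoidalAdjunction L G}
    (pf : ProjectionFormula adj) (X : CenterOb D) :
  IsHalfBraiding (induced_hb pf X).
Proof.
split.
- exact: induced_hb_iso.
- exact: induced_hb_nat.
- exact: induced_hb_tens.
- exact: induced_hb_unit.
Defined.

(** * Lifting [L] and its structure maps to morphisms of the centers *)

Lemma fmap_center_hom {D C : MonCat} {L : OplaxFunctor D C}
    {G : OplaxFunctor C D} {adj : OpmonoidalAdjunction L G}
    (pf : ProjectionFormula adj) (X Y : CenterOb D) (f : Hom (cob X) (cob Y)) :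
  IsCenterHom X Y f ->
  IsCenterHom (Build_CenterOb (induced_half pf X)) (Build_CenterOb (induced_half pf Y))
    (fmap L f).
Proof.
move=> hf A /=; apply: (iso_epi (rproj_iso pf (cob X) A)).
rassoc; rewrite induced_hb_rproj -rproj_nat_l (re2 (induced_hb_rproj _ _ _)).
by rassoc; rewrite -fmap_comp hf fmap_comp (re2 (lproj_nat_r _ _ _)); rassoc.
Qed.

(** The half-braiding of a tensor product moves [A] past [Y], then past [X]. Accordingly
    [oplax_rproj], [rproj_oplax_lproj] and [oplax_lproj] are used in turn, with [A] on the right, in
    the middle and on the left. *)
Lemma oplax_center_hom {D C : MonCat} {L : OplaxFunctor D C}
    {G : OplaxFunctor C D} {adj : OpmonoidalAdjunction L G}
    (pf : ProjectionFormula adj) (X Y : CenterOb D) :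
  IsCenterHom (Build_CenterOb (induced_half pf (center_tens X Y)))
    (center_tens (Build_CenterOb (induced_half pf X)) (Build_CenterOb (induced_half pf Y)))
    (oplax L (cob X) (cob Y)).
Proof.
move=> A; apply: (iso_epi (rproj_iso pf (cob X ⊗ cob Y) A)).
rewrite /= /center_tens_hb /=; rassoc.
rewrite (induced_hb_rproj pf (center_tens X Y)) /= /center_tens_hb.
rewrite (oplax_rproj adj) (re2 (eq_sym (tens_split_r _ _))) induced_hb_rproj.
rewrite tens_split_r; rassoc; rewrite (re2 (eq_sym (oplax_nat_r _ _ _))); rassoc.
(* This is [rproj_oplax_lproj] with each associator moved to the opposite side. *)
have H : associnv (L (cob X)) A (L (cob Y))
      ∘ (id (L (cob X)) ⊠ lproj adj A (cob Y)) ∘ oplax L (cob X) (G A ⊗ cob Y)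
    = (rproj adj (cob X) A ⊠ id (L (cob Y))) ∘ oplax L (cob X ⊗ G A) (cob Y)
      ∘ fmap L (associnv (cob X) (G A) (cob Y)).
  have := f_equal (fun h => associnv _ _ _ ∘ h ∘ fmap L (associnv _ _ _))
    (rproj_oplax_lproj adj (cob X) (cob Y) A).
  simpl; rassoc; rewrite -fmap_comp assoc_r fmap_id comp_id_r => <-.
  by rewrite (re2 (assoc_l _ _ _)) comp_id_l.
rewrite (re3 H); rassoc; rewrite (re2 (eq_sym (tens_split_l _ _))) induced_hb_rproj.
rewrite tens_split_l; rassoc; rewrite (re2 (eq_sym (oplax_nat_l _ _ _))); rassoc.
by rewrite (re3 (oplax_lproj _ _ _ _)); rassoc; rewrite !fmap_comp.
Qed.

Lemma oplax0_center_hom {D C : MonCat} {L : OplaxFunctor D C}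
    {G : OplaxFunctor C D} {adj : OpmonoidalAdjunction L G}
    (pf : ProjectionFormula adj) :
  IsCenterHom (Build_CenterOb (induced_half pf center_unit)) center_unit (oplax0 L).
Proof.
(* Postcomposing with [runit A] cancels the [runitinv A] in the half-braiding of the unit object. *)
move=> A; apply: (iso_epi (rproj_iso pf 𝟙 A)); apply: (iso_mono (runit_iso A)).
rewrite /= /center_unit_hb; rassoc; rewrite (re2 (runit_r _)) comp_id_l.
rewrite oplax0_rproj (induced_hb_rproj pf center_unit) (re3 (oplax0_lproj _ _)).
by rassoc; rewrite -fmap_comp /= /center_unit_hb (re2 (runit_r _)) comp_id_l.
Qed.

(** * The braiding, and assembly of the functor between centers *)

Lemma induced_hb_oplax {D C : MonCat} {L : OplaxFunctor D C}
    {G : OplaxFunctor C D} {adj : OpmonoidalAdjunction L G}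
    (pf : ProjectionFormula adj) (X : CenterOb D) (Y : D) :
  induced_hb pf X (L Y) ∘ oplax L (cob X) Y = oplax L Y (cob X) ∘ fmap L (hb X Y).
Proof.
(* With [oplax] factored through [rproj], the half-braiding of [X] appears at [G (L Y)]; naturality
   along the adjunction unit brings it back to [Y]. *)
rewrite -(rproj_adj_unit adj) (re2 (induced_hb_rproj _ _ _)); rassoc; rewrite -fmap_comp.
by rewrite (hb_nat (hb_half X)) fmap_comp (re2 (lproj_adj_unit _ _ _)).
Qed.

Theorem theorem4p15 (D C : MonCat) (L : OplaxFunctor D C) (G : OplaxFunctor C D)
    (adj : OpmonoidalAdjunction L G) (pf : ProjectionFormula adj) :
  exists ZL_half : forall X : CenterOb D, IsHalfBraiding (induced_hb pf X),
  let ZL_ob (X : Center D) : Center C := Build_CenterOb (ZL_half X) in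
  exists ZL_map : forall (X Y : Center D) (f : Hom X Y),
    IsCenterHom (ZL_ob X) (ZL_ob Y) (fmap L (proj1_sig f)),
  exists ZL_laws : @FunctorLaws (Center D) (Center C) ZL_ob
    (fun X Y f => exist _ _ (ZL_map X Y f)),
  let ZL_functor : Functor (Center D) (Center C) := Build_Functor ZL_laws in
  exists ZL_tens : forall X Y : Center D,
    IsCenterHom (ZL_ob (X ⊗ Y)) (ZL_ob X ⊗ ZL_ob Y) (oplax L (cob X) (cob Y)),
  exists ZL_unit : IsCenterHom (ZL_ob 𝟙) (@munit (Center C)) (oplax0 L),
  exists ZL_oplax : @OplaxLaws (Center D) (Center C) ZL_functor
    (fun X Y => exist _ _ (ZL_tens X Y)) (exist _ _ ZL_unit),
  let ZL : OplaxFunctor (Center D) (Center C) := Build_OplaxFunctor ZL_oplax in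
  IsBraided ZL.
Proof.
exists (induced_half pf) => ZL_ob.
exists (fun X Y f => fmap_center_hom pf X Y (proj1_sig f) (proj2_sig f)).
unshelve eexists.
  by split=> *; apply: center_hom_eq; [exact: fmap_id | exact: fmap_comp].
move=> ZL_functor; exists (oplax_center_hom pf); exists (oplax0_center_hom pf).
unshelve eexists.
(* Composition, tensor products and coherence maps of the centers are the underlying ones, so each
   law is the corresponding law of [L]. *)
{ split=> *; apply: center_hom_eq => /=.
  - exact: oplax_nat.
  - exact: (law_assoc (oplax_laws L)).
  - exact: (law_lunit (oplax_laws L)).
  - exact: (law_runit (oplax_laws L)). }
(* The braiding in the center is the half-braiding of the first object evaluated at the second. *)
by move=> ZL X Y; apply: center_hom_eq; exact: induced_hb_oplax.
Qed.
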